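(* Let $G$ be a connected half-transitive multigraph with bipartition $V_1\cup V_2$ and $\delta(G)\geq 2\mu(G)$. Assume each vertex in $V_1$ has degree $d_1$, each vertex in $V_2$ has degree $d_2$ in $G$, $|V_1|\geq\xi(G)$ and $|V_2|\geq\xi(G)$. Then $G$ is not $\lambda'$-optimal if and only if there is a proper induced connected half-transitive multi-subgraph $H$ of $G$ such that $$d_1'<d_1,\quad d_2'<d_2\quad\text{and}\quad |A_1|(d_1-d_1')+|A_2|(d_2-d_2')\leq \xi(G)-1,$$ where $A_1=V_1\cap V(H)$, $A_2=V_2\cap V(H)$, $d_1'$ is the degree of each vertex of $A_1$ in $H$ and $d_2'$ is the degree of each vertex of $A_2$ in $H$.
   Context: Graphs are finite. A multigraph may have multiple edges but has no loops; the degree $d(u)$ of a vertex $u$ counts edges with multiplicity, and $\delta(G)$ is the minimum degree of $G$. The multiplicity $\mu(e)$ of an edge $e$ is the number of edges having the same two endvertices as $e$, and $\mu(G)=\max_e\mu(e)$. An automorphism of a multigraph is a permutation of its vertex set preserving the number of edges between every pair of vertices. A bipartite multigraph with bipartition $V_1\cup V_2$ is half-transitive if its automorphism group acts transitively both on $V_1$ and on $V_2$; all vertices in the same part then have the same degree. For an induced multi-subgraph $H$ of $G$, half-transitivity is with respect to the bipartition $(V_1\cap V(H))\cup(V_2\cap V(H))$; proper induced means that $H=G[A]$ for some $A\subsetneq V(G)$, all edges of $G$ between vertices of $A$ being kept with their multiplicities. A set $F$ of edges is a restricted edge-cut if $G-F$ is disconnected and has no isolated vertices; the restricted edge-connectivity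 $\lambda'(G)$ is the minimum size (counted with multiplicity) of a restricted edge-cut. The minimum edge degree is $\xi(G)=\min\{d(u)+d(v)-2\mu(e): e=uv\in E(G)\}$. A half-transitive multigraph $G$ is $\lambda'$-optimal if $\lambda'(G)=\xi(G)$. *)

(* Defs.v *)
From HB Require Import structures.
From mathcomp Require Import all_boot all_fingroup.

Set Implicit Arguments.
Unset Strict Implicit.
Unset Printing Implicit Defensive.

(* Parallel edges are distinct elements of [edge] with the same [ends];
   [card_ends] excludes loops. *)
Structure mgraph := MGraph {
  vert :> finType;
  edge : finType;
  ends : edge -> {set vert};
  card_ends : forall e, #|ends e| = 2
}.

Section Invariants.
Variable G : mgraph.
Implicit Types (x y : G) (e : edge G).

Definition degree x : nat := #|[set e | x \in ends e]|.

Definition mult x y : nat := #|[set e : edge G | ends e == [set x; y]]|.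

Definition edge_mult e : nat := #|[set e' | ends e' == ends e]|.

Definition max_mult : nat := \max_(e : edge G) edge_mult e.

(* The neutral element #|edge G| bounds every degree, so it does not affect the
   minimum over a nonempty vertex set. *)
Definition min_degree : nat := \big[minn/#|edge G|]_(x : G) degree x.

(* d(u) + d(v) - 2 mu(e) for e = uv; both degrees are at least mu(e), so the
   subtraction is not truncated. *)
Definition edge_degree e : nat :=
  (\sum_(x in ends e) degree x) - 2 * edge_mult e.

(* As above, every edge degree is at most #|edge G|. *)
Definition min_edge_degree : nat := \big[minn/#|edge G|]_(e : edge G) edge_degree e.

Definition adj : rel G := fun x y => [exists e : edge G, ends e == [set x; y]].

(* The graph with no vertices is not connected. *)
Definition connected : bool :=
  (0 < #|G|) && [forall x : G, forall y : G, connect adj x y].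

Definition automorphism (f : {perm G}) : bool :=
  [forall x, forall y, mult (f x) (f y) == mult x y].

(* Both parts are nonempty, so the common degree of each part of a
   half-transitive multigraph is well defined. *)
Definition bipartition (V1 V2 : {set G}) : Prop :=
  [/\ V1 != set0, V2 != set0, V1 :|: V2 = setT, [disjoint V1 & V2]
    & forall e, #|ends e :&: V1| = 1 /\ #|ends e :&: V2| = 1].

Definition aut_transitive_on (W : {set G}) : Prop :=
  {in W &, forall x y, exists2 f : {perm G}, automorphism f & f x = y}.

Definition half_transitive (V1 V2 : {set G}) : Prop :=
  [/\ bipartition V1 V2, aut_transitive_on V1 & aut_transitive_on V2].

End Invariants.

Section DeleteEdges.
Variables (G : mgraph) (F : {set edge G}).

Definition del_ends (e : {e : edge G | e \notin F}) : {set G} := ends (val e).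

Lemma card_del_ends e : #|del_ends e| = 2.
Proof. exact: card_ends. Qed.

Definition del_edges : mgraph := MGraph card_del_ends.

End DeleteEdges.

Section Induced.
Variables (G : mgraph) (A : {set G}).

Definition trace (W : {set G}) : {set {x : G | x \in A}} :=
  [set x | val x \in W].

Definition induced_ends (e : {e : edge G | ends e \subset A}) :
  {set {x : G | x \in A}} := trace (ends (val e)).

Lemma card_induced_ends e : #|induced_ends e| = 2.
Proof.
rewrite -(card_ends (val e)) -(card_imset _ val_inj); apply: eq_card => x.
apply/imsetP/idP => [[y + ->]|xe]; first by rewrite inE.
have xA : x \in A by apply: subsetP xe; exact: (valP e).
by exists (exist _ x xA); rewrite ?inE.
Qed.

Definition induced : mgraph := MGraph card_induced_ends.

End Induced.

Definition restricted_edge_cut (G : mgraph) (F : {set edge G}) : bool :=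
  ~~ connected (del_edges F) && [forall x : del_edges F, 0 < degree x].

(* The value is #|edge G|.+1, larger than the size of any set of edges (and
   than any edge degree), when G has no restricted edge-cut. *)
Definition restricted_edge_connectivity (G : mgraph) : nat :=
  \big[minn/#|edge G|.+1]_(F : {set edge G} | restricted_edge_cut F) #|F|.

Definition lambda'_optimal (G : mgraph) : Prop :=
  restricted_edge_connectivity G = min_edge_degree G.

(* Main.v *)
Require Import Defs.
From mathcomp Require Import all_boot all_fingroup zify.

(** Call a set [X] of vertices separating if both [X] and its complement
    contain an edge, and let [boundary X] be the set of edges leaving [X]. A
    component of [G - F], for a restricted edge-cut [F], is separating with
    boundary inside [F]. Conversely the boundary of a separating set of minimum
    boundary isolates no vertex, since an isolated vertex could be moved to the
    other side. So the restricted edge-connectivity is the minimum boundary of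
    a separating set. The two ends of an edge are separating and their boundary
    is its edge degree; hence [G] fails to be optimal if and only if some
    separating set has fewer than [min_edge_degree G] boundary edges
    ([not_optimalP]).

    Suppose that such sets exist, and call atoms the smallest sets among the
    separating sets of minimum boundary. The key fact is that two atoms that
    meet are equal ([meeting_atoms_eq]). Removing a vertex [x] from an atom [A]
    leaves a separating set: otherwise [A] spans a star, whose boundary is too
    large because [2 * max_mult G <= min_degree G]. So, by minimality, more than
    half of the edges at [x] stay in [A]; likewise a vertex outside [A] keeps at
    least half of its edges outside [A]. If distinct atoms [A] and [B] meet,
    posimodularity of the boundary prevents both [A :\: B] and [B :\: A] from
    containing an edge. If, say, [B :\: A] is edgeless, a vertex of it has more
    than half of its edges ending in [A :&: B] and at least half of them ending
    outside [A] and [B], which is absurd.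

    Atoms are therefore blocks of the automorphism group: an automorphism that
    maps a vertex of an atom [A] to a vertex of [A] preserves [A], and the
    subgraph induced by [A] is half-transitive. It is connected by minimality.
    As [G] is connected some edge leaves [A], and transitivity carries it to
    every vertex of [A], even from the opposite side, because the translates of
    [A] are equal or disjoint ([atom_exit]): both degrees drop. Counting the
    edges that leave [A] at each of its vertices gives the numerical inequality.

    For the converse, the same count says that the given [A] has fewer than
    [min_edge_degree G] boundary edges, and it contains an edge. If its
    complement contained none, each vertex of [V2] would have an edge in the
    boundary of [A], whence [#|V2| <= #|boundary A|], against
    [min_edge_degree G <= #|V2|]. So [A] is separating. *)

Set Implicit Arguments.
Unset Strict Implicit.
Unset Printing Implicit Defensive.

(** * Preliminaries *)

Section Minn.
Variables (I : finType) (P : pred I) (F : I -> nat) (n : nat).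

(** The neutral element [n] is arbitrary, so that [minn] with [n] is not a
    monoid law and the usual rearrangement of big operators is unavailable:
    the bound is read off the list of indices. *)
Lemma bigminn_leq i : P i -> \big[minn/n]_(j | P j) F j <= F i.
Proof.
move=> Pi; have := mem_index_enum i.
elim: (index_enum I) => // j s IHs; rewrite inE big_cons => /orP[/eqP <-|/IHs le_s].
  by rewrite Pi geq_minl.
by case: ifP => // _; rewrite geq_min le_s orbT.
Qed.

Lemma leq_bigminn m :
  m <= n -> (forall i, P i -> m <= F i) -> m <= \big[minn/n]_(j | P j) F j.
Proof.
by move=> lemn leF; elim/big_ind: _ => // x y lex ley; rewrite leq_min lex.
Qed.

End Minn.

Lemma card_sum_mem (T : finType) (S : {set T}) : #|S| = \sum_x (x \in S : nat).
Proof. by rewrite -sum1_card big_mkcond; apply: eq_bigr => x _; case: ifP. Qed.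

(** * Valencies and edge boundaries *)

Section Multigraph.
Variable G : mgraph.
Implicit Types (x y : G) (X Y A B : {set G}) (e : edge G).

Lemma end_other e x : x \in ends e -> exists2 y, x != y & ends e = [set x; y].
Proof.
have /cards2P[a [b [ab ->]]] : #|ends e| == 2 by rewrite card_ends.
rewrite !inE => /orP[] /eqP ->; first by exists b.
by exists a; rewrite 1?eq_sym // setUC.
Qed.

Lemma ends_pair e : exists x y, x != y /\ ends e = [set x; y].
Proof.
have /cards2P[a [b [ab De]]] : #|ends e| == 2 by rewrite card_ends.
by exists a, b.
Qed.

Lemma ends_neq e x y : ends e = [set x; y] -> x != y.
Proof. by move=> De; have := card_ends e; rewrite De cards2; case: eqP. Qed.

Lemma multC x y : mult x y = mult y x.
Proof. by rewrite /mult setUC. Qed.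

Lemma multxx x : mult x x = 0.
Proof.
apply: eq_card0 => e; rewrite inE; apply/eqP => De.
by have := card_ends e; rewrite De setUid cards1.
Qed.

Lemma mult_gt0P x y : reflect (exists e, ends e = [set x; y]) (0 < mult x y).
Proof.
rewrite card_gt0; apply: (iffP (set0Pn _)) => -[e]; first by rewrite inE => /eqP; exists e.
by move=> De; exists e; rewrite inE De.
Qed.

Lemma leq_max_mult x y : mult x y <= max_mult G.
Proof.
case: (posnP (mult x y)) => [-> //|/mult_gt0P[e De]].
by rewrite /mult -De; apply: (leq_bigmax e).
Qed.

Lemma double_mult_degree x y :
  2 * max_mult G <= min_degree G -> 2 * mult x y <= degree x.
Proof.
move=> Gdelta; apply: leq_trans (bigminn_leq _ _ (erefl true)).
by apply: leq_trans Gdelta; rewrite leq_mul2l leq_max_mult.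
Qed.

Definition valency x Y := \sum_(y in Y) mult x y.

Lemma valencyID x Y Z :
  valency x Y = valency x (Y :&: Z) + valency x (Y :\: Z).
Proof. exact: big_setID. Qed.

(** The only bridge from the edge counts [degree] and [boundary] to sums of
    multiplicities, which are what automorphisms preserve. *)
Lemma valencyE x Y :
  valency x Y = #|[set e | x \in ends e & ends e :\ x \subset Y]|.
Proof.
rewrite -sum1_card big_mkcond /=.
under eq_bigr => e _.
  rewrite (_ : (if _ then _ else _) = \sum_(y in Y) (ends e == [set x; y])); first over.
  rewrite inE; case: (boolP (x \in ends e)) => /= [/end_other[z xz De]|xNe]; last first.
    rewrite big1 // => y _; case: eqP => // De.
    by rewrite De !inE eqxx in xNe.
  have eqe y : (ends e == [set x; y]) = (z == y).
    apply/eqP/eqP => [|<- //]; rewrite De => /setP/(_ z).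
    by rewrite !inE eqxx orbT eq_sym (negbTE xz) /= => /esym/eqP.
  have -> : ends e :\ x = [set z].
    by apply/setP => w; rewrite De !inE; case: eqVneq => //= ->; rewrite (negbTE xz).
  rewrite sub1set; under eq_bigr => y _ do rewrite eqe.
  case: ifP => zY.
    rewrite (bigD1 z) //= eqxx big1 // => y /andP[_ /negbTE]; rewrite eq_sym => -> //.
  by rewrite big1 // => y yY; case: eqP zY yY => // ->->.
rewrite exchange_big /=; apply: eq_bigr => y _.
rewrite /mult -sum1_card big_mkcond; apply: eq_bigr => e _.
by rewrite inE; case: eqP.
Qed.

Lemma degree_valency x Y : degree x = valency x Y + valency x (~: Y).
Proof.
rewrite -setTD -[X in valency x X]setTI -valencyID valencyE.
by apply: eq_card => e; rewrite !inE subsetT andbT.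
Qed.

Lemma valency_gt0P x Y :
  reflect (exists2 y, y \in Y & 0 < mult x y) (0 < valency x Y).
Proof.
rewrite lt0n sum_nat_eq0 negb_forall; apply: (iffP existsP) => -[y].
  by rewrite negb_imply -lt0n => /andP[]; exists y.
by move=> yY m; exists y; rewrite negb_imply -lt0n yY.
Qed.

(** Loops being excluded, these are the edges with exactly one end in [X]. *)
Definition boundary X := [set e | #|ends e :&: X| == 1].

Lemma in_boundary e x y X :
  ends e = [set x; y] -> (e \in boundary X) = (x \in X) (+) (y \in X).
Proof.
move=> De; have xy := ends_neq De.
rewrite inE De setIUl cardsU.
have -> : [set x] :&: X :&: ([set y] :&: X) = set0.
  by apply/setP => z; rewrite !inE; case: eqVneq => // ->; rewrite (negbTE xy) andbF.
rewrite cards0 subn0.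
have c1 (z : G) : #|[set z] :&: X| = (z \in X).
  case: (boolP (z \in X)) => zX; first by rewrite (setIidPl _) ?sub1set // cards1.
  by apply/eqP; rewrite cards_eq0 setI_eq0 disjoints1.
by rewrite !c1; do 2 case: (_ \in X).
Qed.

Lemma boundaryC X : boundary (~: X) = boundary X.
Proof.
apply/setP => e; have [x [y [_ De]]] := ends_pair e.
by rewrite !(in_boundary _ De) !inE addNb addbN negbK.
Qed.

(** Checked edge by edge: it only depends on which of the four cells cut out
    by [A] and [B] contain the two ends of the edge. *)
Lemma boundary_posimodular A B :
  #|boundary (A :\: B)| + #|boundary (B :\: A)| <= #|boundary A| + #|boundary B|.
Proof.
rewrite !card_sum_mem -!big_split; apply: leq_sum => e _ /=.
have [x [y [_ De]]] := ends_pair e.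
by rewrite !(in_boundary _ De) !inE; do 4 case: (_ \in _).
Qed.

(** An edge is in the boundary exactly when it has one end [x] in [X], and
    then it is counted once, at [x]. *)
Lemma card_boundary X : #|boundary X| = \sum_(x in X) valency x (~: X).
Proof.
under eq_bigr do rewrite valencyE card_sum_mem.
rewrite exchange_big /= card_sum_mem; apply: eq_bigr => e _.
rewrite inE (eq_bigr (fun x => (ends e :&: X == [set x]) : nat)); last first.
  move=> x xX; rewrite inE eqEsubset sub1set inE xX andbT andbC.
  by rewrite -[X in _ :&: X]setCK -setDE !subDset setUC.
case: (boolP (#|_| == 1)) => [/cards1P[x Dx]|e1].
  have xX : x \in X by have := set11 x; rewrite -Dx inE => /andP[].
  rewrite (bigD1 x) //= {1}Dx eqxx big1 // => y /andP[_ yx].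
  by rewrite Dx (inj_eq set1_inj) eq_sym (negbTE yx).
by rewrite big1 // => x _; case: (_ =P [set x]) => // Ex; rewrite Ex cards1 in e1.
Qed.

(** When [x] leaves [X], its edges to the outside stop being boundary edges
    and its edges to [X] become boundary edges. *)
Lemma boundaryD1 X x :
  x \in X -> #|boundary (X :\ x)| + degree x = #|boundary X| + 2 * valency x X.
Proof.
move=> xX; rewrite !card_boundary (degree_valency x X) [in RHS](big_setD1 x) //=.
have -> : \sum_(y in X :\ x) valency y (~: (X :\ x))
    = \sum_(y in X :\ x) valency y (~: X) + valency x X.
  rewrite /valency [in RHS](big_setD1 x xX) /= multxx add0n -big_split /=.
  apply: eq_bigr => y _; rewrite multC addnC -big_setU1 ?inE ?xX //=.
  by apply: eq_bigl => z; rewrite !inE negb_and negbK.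
lia.
Qed.

Lemma boundary0 : boundary set0 = set0.
Proof. by apply/setP => e; rewrite !inE setI0 cards0. Qed.

Lemma card_boundary1 x : #|boundary [set x]| = degree x.
Proof.
have := boundaryD1 (set11 x); rewrite setDv boundary0 cards0 /valency big_set1 multxx.
by lia.
Qed.

Lemma card_boundary_ends e : #|boundary (ends e)| = edge_degree e.
Proof.
have [x [y [xy De]]] := ends_pair e.
have De1 : ends e :\ y = [set x].
  by apply/setP => z; rewrite De !inE; case: eqVneq => [->|_];
    rewrite ?orbF //= eq_sym (negbTE xy).
have ye : y \in ends e by rewrite De set22.
have := boundaryD1 ye; rewrite De1 card_boundary1 /valency De.
rewrite !big_setU1 ?inE //= !big_set1 multxx addn0 multC => E.
have -> : edge_degree e = degree x + degree y - 2 * mult x y.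
  by rewrite /edge_degree De big_setU1 ?inE //= big_set1 /mult -De.
lia.
Qed.

(** * Separating sets and atoms *)

Definition has_edge X := [exists e, ends e \subset X].

(** The boundary of a separating set need not be a restricted edge-cut, as it
    may isolate vertices; but the minima over both families agree, and being
    separating passes to any subset that still contains an edge. *)
Definition separating X := has_edge X && has_edge (~: X).

Lemma has_edgeS X Y : X \subset Y -> has_edge X -> has_edge Y.
Proof.
by move=> sXY /existsP[e eX]; apply/existsP; exists e; apply: subset_trans sXY.
Qed.

Lemma separatingC X : separating (~: X) = separating X.
Proof. by rewrite /separating setCK andbC. Qed.

Lemma separatingS X Y : separating X -> Y \subset X -> has_edge Y -> separating Y.
Proof.
case/andP=> _ eXC sYX eY; rewrite /separating eY (has_edgeS _ eXC) //.
by rewrite setCS.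
Qed.

Lemma has_edgeP X :
  reflect (exists x y, [/\ x \in X, y \in X & 0 < mult x y]) (has_edge X).
Proof.
apply: (iffP existsP) => [[e eX]|[x [y [xX yX /mult_gt0P[e De]]]]].
  have [x [y [_ De]]] := ends_pair e; exists x, y.
  move: eX; rewrite De subUset !sub1set => /andP[-> ->]; split => //.
  by apply/mult_gt0P; exists e.
by exists e; rewrite De subUset !sub1set xX.
Qed.

Lemma valency_edgeless X x : ~~ has_edge X -> x \in X -> valency x X = 0.
Proof.
move=> noX xX; apply/eqP; rewrite -leqn0 leqNgt; apply/negP => /valency_gt0P[y yX xy].
by case/negP: noX; apply/has_edgeP; exists x, y.
Qed.

Lemma has_edgeD1 X x : valency x X = 0 -> has_edge X -> has_edge (X :\ x).
Proof.
move=> x0 /has_edgeP[y [z [yX zX yz]]]; apply/has_edgeP; exists y, z.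
have {x0} x0 w : w \in X -> mult x w = 0.
  by move=> wX; apply/eqP; move/eqP: x0; rewrite sum_nat_eq0 => /forall_inP/(_ w wX).
rewrite !inE yX zX !andbT; split=> //; apply/eqP.
  by move=> yx; rewrite yx x0 in yz.
by move=> zx; rewrite zx multC x0 in yz.
Qed.

(** [X] spans a star centred at [x]. A leaf [z] sends at most half of its
    edges to [x], since [2 * max_mult G <= min_degree G], so that removing it
    does not increase the boundary. Removing all leaves but one leaves the two
    ends of an edge, whose boundary is at least the minimum edge degree. *)
Lemma star_boundary X x :
    2 * max_mult G <= min_degree G -> x \in X -> has_edge X ->
  ~~ has_edge (X :\ x) -> min_edge_degree G <= #|boundary X|.
Proof.
move=> Gdelta; have [n] := ubnP #|X|; elim: n X => // n IHn X leXn xX eX starX.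
have /existsP[e eX1] := eX.
have xe : x \in ends e.
  by apply: contraR starX => xe; apply/existsP; exists e; rewrite subsetD1 eX1.
have [Xe|] := eqVneq X (ends e).
  by rewrite Xe card_boundary_ends; apply: bigminn_leq.
rewrite eqEsubset eX1 andbT => /subsetPn[z zX ze].
have zx : z != x by apply: contraNneq ze => ->.
have lez : 2 * valency z X <= degree z.
  have -> : valency z X = mult z x; last exact: double_mult_degree.
  rewrite /valency (big_setD1 x) //= -[RHS]addn0; congr addn.
  by apply: (valency_edgeless starX); rewrite !inE zx.
have := boundaryD1 zX; have : min_edge_degree G <= #|boundary (X :\ z)|; last by lia.
apply: IHn.
- by move: leXn; rewrite (cardsD1 z X) zX.
- by rewrite !inE eq_sym zx.
- by apply/existsP; exists e; rewrite subsetD1 eX1.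
- by apply: contra starX; apply: has_edgeS; rewrite setSD ?subD1set.
Qed.

Definition min_separating X :=
  separating X /\ forall Y, separating Y -> #|boundary X| <= #|boundary Y|.

Lemma min_separatingC X : min_separating X -> min_separating (~: X).
Proof. by case=> sepX minX; split; rewrite ?separatingC // boundaryC. Qed.

Lemma ex_min_separating X :
  separating X -> exists2 Y, min_separating Y & #|boundary Y| <= #|boundary X|.
Proof.
move=> sepX; case: (arg_minnP (fun X => #|boundary X|) sepX) => Y sepY minY.
by exists Y => //; apply: minY.
Qed.

(** A vertex of [X] without neighbours in [X] could be moved to the other
    side, which would shrink the boundary by its degree. Hence the boundary of
    a smallest separating set isolates no vertex. *)
Lemma min_separating_valency X x :
  min_separating X -> 0 < degree x -> x \in X -> 0 < valency x X.
Proof.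
move=> [sepX minX] dx xX; rewrite lt0n; apply/eqP => x0.
have /minX : separating (X :\ x).
  by apply: (separatingS sepX (subD1set _ _)); apply: has_edgeD1 x0 _; case/andP: sepX.
have := boundaryD1 xX; lia.
Qed.

(** By [star_boundary], [X :\ x] still contains an edge; so it is separating,
    and its boundary cannot be smaller than that of [X]. *)
Lemma min_separating_half_degree X x :
    2 * max_mult G <= min_degree G -> min_separating X ->
    #|boundary X| < min_edge_degree G -> x \in X ->
  separating (X :\ x) /\ degree x <= 2 * valency x X.
Proof.
move=> Gdelta [sepX minX] ltX xX.
have sepX1 : separating (X :\ x).
  apply: (separatingS sepX); first exact: subD1set.
  apply: contraLR ltX => star; rewrite -leqNgt; apply: star_boundary star => //.
  by case/andP: sepX.
by split=> //; have := boundaryD1 xX; have := minX _ sepX1; lia.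
Qed.

(** The second clause compares only sets of the same boundary size, the
    minimum one. *)
Definition atom A :=
  min_separating A /\ forall X, min_separating X -> #|A| <= #|X|.

Lemma ex_atom X : separating X -> exists2 A, atom A & #|boundary A| <= #|boundary X|.
Proof.
case/ex_min_separating => Y [sepY minY] leYX.
(* All minimum separating sets have the boundary size of [Y]. *)
pose P Z := separating Z && (#|boundary Z| == #|boundary Y|).
have PY : P Y by rewrite /P sepY eqxx.
case: (arg_minnP (fun Z : {set G} => #|Z|) PY) => A /andP[sepA /eqP eqA] minA.
exists A; last by rewrite eqA.
split=> [|Z [sepZ minZ]]; first by split=> // Z; rewrite eqA; apply: minY.
by apply: minA; rewrite /P sepZ eqn_leq minZ // minY.
Qed.

Lemma atom_lt A X : atom A -> separating X -> #|X| < #|A| -> #|boundary A| < #|boundary X|.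
Proof.
move=> [[sepA minA] leA] sepX; rewrite !ltnNge; apply: contra => leXA.
by apply: leA; split=> // Y /minA; apply: leq_trans.
Qed.

(** The inequality is strict, unlike in [min_separating_half_degree], because
    [A :\ x] is a smaller separating set than the atom [A]. *)
Lemma atom_half_degree A x :
    2 * max_mult G <= min_degree G -> atom A ->
    #|boundary A| < min_edge_degree G -> x \in A ->
  degree x < 2 * valency x A.
Proof.
move=> Gdelta atomA ltA xA.
have [sepA1 _] := min_separating_half_degree Gdelta (proj1 atomA) ltA xA.
have := atom_lt atomA sepA1; rewrite [#|A|](cardsD1 x) xA ltnSn => /(_ isT).
have := boundaryD1 xA; lia.
Qed.

(** If [B :\: A] is edgeless, a vertex of it has more than half of its edges
    going to [B], hence to [A :&: B], and at least half of them going to the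
    complement of [A], hence outside both [A] and [B]: too many. *)
Lemma atom_difference A B :
    2 * max_mult G <= min_degree G -> atom A -> atom B ->
    #|boundary A| < min_edge_degree G ->
  has_edge (B :\: A) \/ B \subset A.
Proof.
move=> Gdelta atomA atomB ltA.
have eqAB : #|boundary A| = #|boundary B|.
  apply/eqP; case: atomA atomB => -[sepA minA] _ [[sepB minB] _].
  by rewrite eqn_leq minA ?minB.
case: (boolP (has_edge _)) => [|noQ]; [by left | right].
apply: contraT => /subsetPn[x xB xA].
have xQ : x \in B :\: A by rewrite inE xA.
have xAC : x \in ~: A by rewrite inE.
have ltB := ltA; rewrite eqAB in ltB.
have ltAC := ltA; rewrite -boundaryC in ltAC.
have hB := atom_half_degree Gdelta atomB ltB xB.
have [_ hA] := min_separating_half_degree Gdelta (min_separatingC (proj1 atomA)) ltAC xAC.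
have := degree_valency x A; have := valency_edgeless noQ xQ.
have := valencyID x B A; have : valency x (B :&: A) <= valency x A; last by lia.
by rewrite (valencyID x A B) setIC leq_addr.
Qed.

(** Otherwise both differences contain edges, hence are separating;
    [A :\: B] is smaller than [A] because the atoms meet, so its boundary is
    strictly larger than the minimum, against posimodularity. *)
Lemma meeting_atoms_eq A B :
    2 * max_mult G <= min_degree G -> atom A -> atom B ->
    #|boundary A| < min_edge_degree G -> A :&: B != set0 -> A = B.
Proof.
move=> Gdelta atomA atomB ltA meetAB.
have [[sepA minA] leA] := atomA; have [[sepB minB] leB] := atomB.
have eqAB : #|boundary A| = #|boundary B| by apply/eqP; rewrite eqn_leq minA ?minB.
have eqcAB : #|A| = #|B|
  by apply/eqP; rewrite eqn_leq (leA _ (proj1 atomB)) (leB _ (proj1 atomA)).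
have [eQ|sBA] := atom_difference Gdelta atomA atomB ltA; last first.
  by apply/esym/eqP; rewrite eqEcard sBA eqcAB leqnn.
have [|eP|sAB] := atom_difference Gdelta atomB atomA; first by rewrite -eqAB.
  have I0 : 0 < #|A :&: B| by rewrite card_gt0.
  have ltP : #|boundary A| < #|boundary (A :\: B)|.
    apply: atom_lt => //; first exact: separatingS sepA (subsetDl _ _) eP.
    by rewrite -(cardsID B A); lia.
  have leQ : #|boundary B| <= #|boundary (B :\: A)|.
    by apply: minB; apply: separatingS sepB (subsetDl _ _) eQ.
  by have := boundary_posimodular A B; lia.
by apply/eqP; rewrite eqEcard sAB eqcAB leqnn.
Qed.

(** * Restricted edge-cuts as boundaries of separating sets *)

Lemma boundary_ends e X :
  e \in boundary X -> exists x y, [/\ x \in X, y \notin X & ends e = [set x; y]].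
Proof.
have [x [y [_ De]]] := ends_pair e; rewrite (in_boundary X De).
case: (boolP (x \in X)) => [xX|xX] /= yX; first by exists x, y.
by exists y, x; rewrite yX xX setUC.
Qed.

Lemma notin_boundary_ends e X x :
  x \in ends e -> x \in X -> e \notin boundary X -> ends e \subset X.
Proof.
move=> /end_other[y _ De] xX; rewrite (in_boundary X De) xX /= negbK => yX.
by rewrite De subUset !sub1set xX.
Qed.

Lemma connected_boundary X x y :
  connected G -> x \in X -> y \notin X -> exists e, e \in boundary X.
Proof.
case/andP=> _ /forallP/(_ x)/forallP/(_ y) cxy xX yX.
apply/set0Pn; apply: contraNneq yX => bX0.
have clX : closed (@adj G) (mem X).
  move=> a b /existsP[e /eqP De]; apply/eqP.
  by have := in_boundary X De; rewrite bX0 inE => /esym/negbT; rewrite negb_add.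
by rewrite -(closed_connect clX cxy).
Qed.

(** [X] is the component of a vertex in [G - F]. As no vertex is isolated in
    [G - F], both [X] and its complement contain an edge. *)
Lemma restricted_cut_separating (F : {set edge G}) :
    0 < #|G| -> restricted_edge_cut F ->
  exists2 X, separating X & boundary X \subset F.
Proof.
rewrite /restricted_edge_cut /connected => -> /andP[/= ncF /forallP degF].
have {ncF} [x /forallPn[y ncxy]] := forallPn ncF.
pose X := [set z : G | connect (@adj (del_edges F)) x z].
have bXF : boundary X \subset F.
  apply/subsetP => e /boundary_ends[a [b [aX bX De]]]; apply: contraR bX => eF.
  move: aX; rewrite !inE => ca; apply: connect_trans ca _; apply: connect1.
  by apply/existsP; exists (exist _ e eF); rewrite /= /del_ends /= De.
have edgeF z Y : boundary Y \subset F -> z \in Y -> has_edge Y.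
  move=> bYF zY; have /card_gt0P[[e eF]] := degF z; rewrite inE /= /del_ends /= => ze.
  apply/existsP; exists e; apply: notin_boundary_ends ze zY _.
  by apply: contra eF; apply: (subsetP bYF).
exists X => //; rewrite /separating (edgeF x) ?inE ?connect0 //=.
by rewrite (edgeF y) ?boundaryC // !inE.
Qed.

Lemma min_separating_cut X :
    (forall x, 0 < degree x) -> min_separating X -> restricted_edge_cut (boundary X).
Proof.
move=> deg_gt0 minX; have [[/andP[eX eXC] _] minXC] := (minX, min_separatingC minX).
apply/andP; split.
  apply/negP => /andP[_ /forallP conn].
  have /has_edgeP[x [_ [xX _ _]]] := eX; have /has_edgeP[y [_ [yX _ _]]] := eXC.
  have {conn} /forallP/(_ y) cxy := conn x.
  have clX : closed (@adj (del_edges (boundary X))) (mem X).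
    move=> a b /existsP[[e eb] /eqP]; rewrite /= /del_ends /= => De.
    by apply/eqP; move: eb; rewrite (in_boundary X De) negb_add.
  by move: yX; rewrite inE -(closed_connect clX cxy) xX.
suff edge_at Y x : min_separating Y -> boundary Y = boundary X -> x \in Y ->
    0 < @degree (del_edges (boundary X)) x.
  apply/forallP => x; case: (boolP (x \in X)) => [|xX]; first exact: edge_at.
  by apply: (edge_at (~: X)); rewrite ?boundaryC ?inE.
move=> minY eqb xY.
have /valency_gt0P[y yY /mult_gt0P[e De]] := min_separating_valency minY (deg_gt0 x) xY.
have eb : e \notin boundary X by rewrite -eqb (in_boundary Y De) xY yY.
by apply/card_gt0P; exists (exist _ e eb); rewrite inE /= /del_ends /= De set21.
Qed.

Section Bipartite.
Variables V1 V2 : {set G}.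
Hypotheses (Gconn : connected G) (Gbip : bipartition V1 V2).
Hypothesis (Gdelta : 2 * max_mult G <= min_degree G).

Lemma bip_sideC : V2 = ~: V1.
Proof.
case: Gbip => _ _ VU dV _; apply/setP => x; rewrite inE.
have := in_setT x; rewrite -VU inE.
case: (boolP (x \in V1)) => //= xV1 _; first by rewrite (disjointFr dV).
Qed.

Lemma bip_boundary e : e \in boundary V1.
Proof. by case: Gbip => _ _ _ _ /(_ e)[/eqP e1 _]; rewrite inE. Qed.

Lemma bip_ends e x y : ends e = [set x; y] -> (y \in V1) = (x \notin V1).
Proof. by move=> /(in_boundary V1); rewrite bip_boundary; do 2 case: (_ \in V1). Qed.

Lemma bip_has_edge : 0 < #|edge G|.
Proof.
case: Gbip => /set0Pn[x xV1] /set0Pn[y yV2] _ _ _.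
have [|e _] := connected_boundary Gconn xV1 (_ : y \notin V1);
  last by apply/card_gt0P; exists e.
by rewrite bip_sideC inE in yV2.
Qed.

Lemma bip_degree_gt0 x : 0 < degree x.
Proof.
have /card_gt0P[e _] := bip_has_edge; have [a [b [_ De]]] := ends_pair e.
apply: leq_trans (bigminn_leq _ _ (erefl true)).
apply: leq_trans Gdelta; rewrite muln_gt0 /=; apply: leq_trans (leq_max_mult a b).
by apply/mult_gt0P; exists e.
Qed.

(** The degree of [x] is positive and at least twice the multiplicity of [x]
    and [y], so that not all edges at [x] go to [y]. *)
Lemma bip_other_neighbour x y : exists2 z, z != y & 0 < mult x z.
Proof.
have : 0 < valency x (~: [set y]).
  have := degree_valency x [set y]; rewrite [valency x [set y]]/valency big_set1.
  by have := double_mult_degree x y Gdelta; have := bip_degree_gt0 x; lia.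
by case/valency_gt0P => z; rewrite !inE; exists z.
Qed.

(** From the edge [uv], a second neighbour [w] of [u] and a second neighbour
    [z] of [w] give the edge [wz]; it avoids [v] because [z] and [v] are on
    different sides. *)
Lemma bip_separating_ends e : separating (ends e).
Proof.
apply/andP; split; first by apply/existsP; exists e.
have [u [v [uv De]]] := ends_pair e.
have [w wv uw] := bip_other_neighbour u v; have [z zu wz] := bip_other_neighbour w u.
have /mult_gt0P[e1 De1] := uw; have /mult_gt0P[e2 De2] := wz.
have uw1 := ends_neq De1.
have zv : z != v.
  apply/eqP => zv; have := bip_ends De; have := bip_ends De1; have := bip_ends De2.
  by rewrite zv; do 3 case: (_ \in V1).
apply/has_edgeP; exists w, z; rewrite De !inE !negb_or wv zv zu eq_sym uw1.
by split.
Qed.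

Lemma lambda'_lt_separating :
  restricted_edge_connectivity G < min_edge_degree G <->
  exists2 X, separating X & #|boundary X| < min_edge_degree G.
Proof.
have /card_gt0P[e0 _] := bip_has_edge; split=> [ltG|[X sepX ltX]].
  have [/existsP[F /andP[cutF ltF]]|] :=
    boolP [exists F : {set edge G}, restricted_edge_cut F && (#|F| < min_edge_degree G)].
    have [|X sepX bX] := restricted_cut_separating _ cutF; first by case/andP: Gconn.
    by exists X => //; apply: leq_ltn_trans ltF; apply: subset_leq_card.
  rewrite negb_exists => /forallP noF; move: ltG; rewrite ltnNge => /negP[].
  apply: leq_bigminn => [|F cutF]; last by have := noF F; rewrite cutF /= -leqNgt.
  apply: leq_trans (_ : edge_degree e0 <= _); first exact: bigminn_leq.
  rewrite -card_boundary_ends; apply: leqW; exact: max_card.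
have [Y minY leYX] := ex_min_separating sepX.
apply: leq_ltn_trans (leq_ltn_trans leYX ltX).
by apply: bigminn_leq; apply: min_separating_cut => //; apply: bip_degree_gt0.
Qed.

(** The two ends of an edge form a separating set whose boundary is counted by
    the edge degree; in particular restricted edge-cuts exist. *)
Lemma leq_lambda'_min_edge_degree :
  restricted_edge_connectivity G <= min_edge_degree G.
Proof.
have leS X : separating X -> restricted_edge_connectivity G <= #|boundary X|.
  case/ex_min_separating=> Y minY; apply: leq_trans.
  by apply: bigminn_leq; apply: min_separating_cut => //; apply: bip_degree_gt0.
have /card_gt0P[e0 _] := bip_has_edge; apply: leq_bigminn => [|e _].
  by apply: leq_trans (leS _ (bip_separating_ends e0)) _; apply: max_card.
by rewrite -card_boundary_ends leS ?bip_separating_ends.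
Qed.

Lemma not_optimalP :
  ~ lambda'_optimal G <-> exists2 X, separating X & #|boundary X| < min_edge_degree G.
Proof.
rewrite -lambda'_lt_separating ltn_neqAle leq_lambda'_min_edge_degree andbT.
by split=> /eqP.
Qed.

End Bipartite.

(** * Automorphisms *)

Section Automorphisms.
Variable f : {perm G}.
Hypothesis autf : automorphism f.

Lemma aut_mult x y : mult (f x) (f y) = mult x y.
Proof. by apply/eqP; move/forallP: autf => /(_ x)/forallP. Qed.

Lemma aut_valency x Y : valency (f x) (f @: Y) = valency x Y.
Proof.
rewrite /valency big_imset /=; last by move=> y z _ _; apply: perm_inj.
by apply: eq_bigr => y _; apply: aut_mult.
Qed.

Lemma aut_degree x : degree (f x) = degree x.
Proof.
have fT : f @: setT = setT.
  by apply/setP => y; rewrite -(permKV f y) mem_imset ?inE //; apply: perm_inj.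
by rewrite !(degree_valency _ setT) -{1}fT setCT aut_valency /valency !big_set0.
Qed.

Lemma aut_setC X : ~: (f @: X) = f @: ~: X.
Proof.
apply/setP => y; rewrite -(permKV f y) inE !mem_imset ?inE //; exact: perm_inj.
Qed.

Lemma aut_boundary X : #|boundary (f @: X)| = #|boundary X|.
Proof.
rewrite !card_boundary aut_setC big_imset /=; last by move=> y z _ _; apply: perm_inj.
by apply: eq_bigr => x _; apply: aut_valency.
Qed.

Lemma aut_has_edge X : has_edge X -> has_edge (f @: X).
Proof.
case/has_edgeP => x [y [xX yX xy]]; apply/has_edgeP; exists (f x), (f y).
by rewrite !imset_f ?aut_mult.
Qed.

Lemma aut_atom A : atom A -> atom (f @: A).
Proof.
case=> [[/andP[eA eAC] minA] leA]; split.
  split; first by rewrite /separating aut_setC !aut_has_edge.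
  by move=> X; rewrite aut_boundary; apply: minA.
by move=> X minX; rewrite card_imset ?leA //; apply: perm_inj.
Qed.

End Automorphisms.

End Multigraph.

(** * Induced subgraphs *)

Section InducedAtoms.
Variable G : mgraph.
Implicit Types (x y : G) (X Y A S W : {set G}) (e : edge G).

Section InducedSubgraph.
Variable A : {set G}.

Lemma mult_induced (x y : induced A) : mult x y = mult (val x) (val y).
Proof.
rewrite /mult -(card_imset _ val_inj); apply: eq_card => e; rewrite inE.
apply/imsetP/eqP => [[e'] | De].
  rewrite inE /= /induced_ends => /eqP/setP De' ->; apply/setP => z.
  case: (boolP (z \in A)) => zA.
    by have := De' (exist _ z zA); rewrite !inE /= => ->.
  have /negbTE -> : z \notin ends (val e') by apply: contra zA; apply: (subsetP (valP e')).
  rewrite !inE; apply/esym/negbTE; rewrite negb_or.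
  by apply/andP; split; apply: contraNneq zA => ->; apply: valP.
have eA : ends e \subset A by rewrite De subUset !sub1set (valP x) (valP y).
exists (exist _ e eA) => //; rewrite inE /= /induced_ends /= De.
by apply/eqP/setP => z; rewrite !inE.
Qed.

Lemma induced_valency (x : induced A) : degree x = valency (val x) A.
Proof.
rewrite (degree_valency x setT) setCT /valency big_set0 addn0.
have -> : \sum_(y in A) mult (val x) y = \sum_(y in val @: [set: induced A]) mult (val x) y.
  apply: eq_bigl => y; apply/idP/imsetP => [yA|[z _ ->]]; last exact: valP.
  by exists (exist _ y yA).
rewrite big_imset /=; last by move=> y z _ _; apply: val_inj.
by apply: eq_bigr => y _; apply: mult_induced.
Qed.

Lemma card_trace (W : {set G}) : #|trace A W| = #|A :&: W|.
Proof.
rewrite -(card_imset _ val_inj); apply: eq_card => x; rewrite inE.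
apply/imsetP/andP => [[y + ->]|[xA xW]]; first by rewrite inE => yW; rewrite (valP y).
by exists (exist _ x xA); rewrite ?inE.
Qed.

Lemma trace_bipartition V1 V2 :
  has_edge A -> bipartition V1 V2 -> @bipartition (induced A) (trace A V1) (trace A V2).
Proof.
move=> eA [_ _ VU dV cV].
have card_ends_trace (e : edge (induced A)) (W : {set G}) :
    #|ends e :&: trace A W| = #|ends (val e) :&: W|.
  rewrite (_ : _ :&: _ = trace A (ends (val e) :&: W)).
    by rewrite card_trace setIA (setIidPr (valP e)).
  by apply/setP => x; rewrite !inE.
have /existsP[e eA1] := eA.
have trace0 W : #|ends e :&: W| = 1 -> trace A W != set0.
  rewrite -card_gt0 card_trace => eW; apply: leq_trans (_ : #|ends e :&: W| <= _).
    by rewrite eW.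
  by rewrite subset_leq_card ?setSI.
have [e1 e2] := cV e; split; rewrite ?trace0 //.
- by apply/setP => x; have := in_setT (val x); rewrite -VU !inE.
- by apply/pred0P => x; have /pred0P/(_ (val x)) := dV; rewrite /= !inE.
by move=> e'; rewrite !card_ends_trace; apply: cV.
Qed.

Lemma induced_aut (f : {perm G}) (x y : induced A) :
    automorphism f -> f @: A = A -> f (val x) = val y ->
  exists2 g : {perm induced A}, automorphism g & g x = y.
Proof.
move=> autf fA fx.
have fI (z : induced A) : f (val z) \in A by have := imset_f f (valP z); rewrite fA.
pose h (z : induced A) : induced A := exist _ (f (val z)) (fI z).
have hI : injective h by move=> z t /(congr1 val)/= /perm_inj/val_inj.
exists (perm hI); last by apply: val_inj; rewrite permE.
apply/forallP => z; apply/forallP => t.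
by rewrite !permE !mult_induced /= aut_mult.
Qed.

Lemma card_boundary_sides V1 V2 d1 d2 d1' d2' :
    bipartition V1 V2 ->
    {in V1, forall x, degree x = d1} -> {in V2, forall x, degree x = d2} ->
    {in trace A V1, forall x : induced A, degree x = d1'} ->
    {in trace A V2, forall x : induced A, degree x = d2'} ->
  #|boundary A| = #|V1 :&: A| * (d1 - d1') + #|V2 :&: A| * (d2 - d2').
Proof.
move=> Gbip D1 D2 D1' D2'; rewrite card_boundary (big_setID V1) /= setDE.
rewrite -(bip_sideC Gbip) ![A :&: _]setIC.
have side (W : {set G}) d d' : {in W, forall x, degree x = d} ->
    {in trace A W, forall x : induced A, degree x = d'} ->
    \sum_(x in W :&: A) valency x (~: A) = #|W :&: A| * (d - d').
  move=> D D'; rewrite -sum_nat_const; apply: eq_bigr => x; rewrite inE => /andP[xW xA].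
  have := D' (exist _ x xA); rewrite inE induced_valency /= => /(_ xW) <-.
  by rewrite -(D x xW) (degree_valency x A) addKn.
by rewrite (side _ _ _ D1 D1') (side _ _ _ D2 D2').
Qed.

End InducedSubgraph.

(** * Atoms are blocks of the automorphism group *)

(** If no edge joins [S] to [A :\: S], the boundaries of both parts are
    contained in that of [A], and one of the parts contains an edge: this
    smaller separating set contradicts that [A] is an atom. *)
Lemma atom_inner_edge A S x y :
    atom A -> S \subset A -> x \in S -> y \in A :\: S ->
  exists a b, [/\ a \in S, b \in A :\: S & 0 < mult a b].
Proof.
move=> atomA sSA xS yAS.
case: (boolP [exists a in S, exists b in A :\: S, 0 < mult a b]) => [|noab].
  by case/exists_inP=> a aS /exists_inP[b bS ab]; exists a, b.
have {noab} noab a b : a \in S -> b \in A :\: S -> mult a b = 0.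
  move=> aS bS; apply/eqP; rewrite -leqn0 leqNgt; apply: contra noab => ab.
  by apply/exists_inP; exists a => //; apply/exists_inP; exists b.
have edgeless Y z : Y \subset A -> z \in A :\: Y ->
    {in Y & A :\: Y, forall a b, mult a b = 0} -> ~~ has_edge Y.
  move=> sYA /setDP[zA zY] noY; apply/negP => eY; have [[sepA _] _] := atomA.
  have /(atom_lt atomA (separatingS sepA sYA eY)) : #|Y| < #|A|.
    by apply: proper_card; apply/properP; split=> //; exists z.
  rewrite ltnNge => /negP[]; apply/subset_leq_card/subsetP => e.
  case/boundary_ends=> a [b [aY bY De]]; rewrite (in_boundary A De) (subsetP sYA a aY) /=.
  apply/negP => bA; have : 0 < mult a b by apply/mult_gt0P; exists e.
  by rewrite noY // inE bY.
have noS : ~~ has_edge S := edgeless S y sSA yAS noab.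
have noD : ~~ has_edge (A :\: S).
  apply: (edgeless _ x (subsetDl _ _)).
    by rewrite !inE xS (subsetP sSA).
  move=> a b aD; rewrite setDDr setDv set0U => /setIP[_ bS].
  by rewrite multC noab.
have [[/andP[/has_edgeP[a [b [aA bA ab]]] _] _] _] := atomA.
case: (boolP (a \in S)) (boolP (b \in S)) => aS [] bS.
- by case/negP: noS; apply/has_edgeP; exists a, b.
- by exists a, b; rewrite inE bS bA.
- by exists b, a; rewrite inE aS aA multC.
- by case/negP: noD; apply/has_edgeP; exists a, b; rewrite !inE aS bS.
Qed.

Lemma atom_connected A : atom A -> connected (induced A).
Proof.
move=> atomA; have [[/andP[/has_edgeP[x [_ [xA _ _]]] _] _] _] := atomA.
apply/andP; split; first by apply/card_gt0P; exists (exist _ x xA).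
apply/forallP => u; apply/forallP => v.
pose C : {set induced A} := [set z | connect (@adj (induced A)) u z].
suff : v \in C by rewrite inE.
apply: contraT => vC.
have valC z : (val z \in val @: C) = (z \in C) by rewrite mem_imset //; apply: val_inj.
have [||| a [b [aC bA ab]]] := @atom_inner_edge A (val @: C) (val u) (val v) atomA.
- by apply/subsetP => _ /imsetP[z _ ->]; apply: valP.
- by rewrite valC inE connect0.
- by rewrite inE valC vC (valP v).
have [a' a'C Da] := imsetP aC; case/setDP: bA => bA; case/negP.
pose b' : induced A := exist _ b bA.
have /mult_gt0P[e De] : 0 < mult (a' : induced A) b' by rewrite mult_induced -Da.
apply/imsetP; exists b' => //; rewrite inE in a'C; rewrite inE.
by apply: connect_trans a'C (connect1 _); apply/existsP; exists e; rewrite De.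
Qed.

Section AtomBlocks.
Variable A : {set G}.
Hypotheses (Gconn : connected G) (Gdelta : 2 * max_mult G <= min_degree G).
Hypotheses (atomA : atom A) (ltA : #|boundary A| < min_edge_degree G).

Lemma atom_block (f : {perm G}) z : automorphism f -> z \in A -> z \in f @: A -> f @: A = A.
Proof.
move=> autf zA zfA; symmetry; apply: meeting_atoms_eq => //; first exact: aut_atom.
by apply/set0Pn; exists z; rewrite inE zA.
Qed.

(** Connectedness provides an edge [ab] leaving [A], with one end in [W]. An
    automorphism [f] that maps [x] to that end maps [A] to an atom, which is
    [A] if this end is [a], and avoids [a] if this end is [b]. In both cases
    the edge leaves [f @: A], and its preimage leaves [A] at [x]. *)
Lemma atom_exit W x :
    aut_transitive_on W -> (forall e, #|ends e :&: W| = 1) -> x \in W -> x \in A ->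
  0 < valency x (~: A).
Proof.
move=> transW eW xW xA; have [[/andP[_ /has_edgeP[y [_ [yA _ _]]]] _] _] := atomA.
rewrite inE in yA; have [e /boundary_ends[a [b [aA bA De]]]] := connected_boundary Gconn xA yA.
suff [z' [f [autf f_z' z'fA]]] : exists z' (f : {perm G}),
    [/\ automorphism f, 0 < mult (f x) z' & z' \notin f @: A].
  apply/valency_gt0P; exists (perm_inv f z'); last by rewrite -(aut_mult autf) permKV.
  rewrite inE; apply: contra z'fA => z'A.
  by apply/imsetP; exists (perm_inv f z'); rewrite ?permKV.
have fxA (f : {perm G}) : f x \in f @: A by apply: imset_f.
have ab : 0 < mult a b by apply/mult_gt0P; exists e.
case: (boolP (a \in W)) => aW.
  have [f autf fx] := transW _ _ xW aW; exists b, f; split; rewrite ?fx //.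
  by rewrite (atom_block autf aA) // -fx.
have bW : b \in W.
  have := eW e; apply: contra_eqT => bW; rewrite (_ : _ :&: _ = set0) ?cards0 //.
  apply/eqP; rewrite setI_eq0 De; apply/pred0P => w /=; rewrite !inE.
  by apply/negP => /andP[/orP[]/eqP-> wW]; rewrite wW in aW bW.
have [f autf fx] := transW _ _ xW bW; exists a, f; split; rewrite ?fx 1?multC //.
by apply: contra bA => afA; rewrite -(atom_block autf aA afA) -fx.
Qed.

Lemma atom_transitive W :
  aut_transitive_on W -> @aut_transitive_on (induced A) (trace A W).
Proof.
move=> transW x y; rewrite !inE => xW yW.
have [f autf fx] := transW _ _ xW yW.
apply: (induced_aut autf _ fx); apply: (atom_block autf (valP y)).
by rewrite -fx imset_f ?(valP x).
Qed.

Lemma atom_side_degree W d :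
    aut_transitive_on W -> (forall e, #|ends e :&: W| = 1) ->
    {in W, forall x, degree x = d} -> trace A W != set0 ->
  exists2 d', {in trace A W, forall x : induced A, degree x = d'} & d' < d.
Proof.
move=> transW eW D /set0Pn[x0 x0W]; exists (@degree (induced A) x0).
  by move=> x xW; have [g autg <-] := atom_transitive transW x0W xW; apply: aut_degree.
rewrite inE in x0W; rewrite -(D _ x0W) (degree_valency _ A) induced_valency.
by have := atom_exit transW eW x0W (valP x0); lia.
Qed.
End AtomBlocks.

(** Each edge has a single end in [W], and every vertex of [W] is reached in
    this way from the boundary. *)
Lemma leq_side_boundary (A W : {set G}) :
    (forall e, #|ends e :&: W| = 1) ->
    (forall x, x \in W -> exists2 e, e \in boundary A & x \in ends e) ->
  #|W| <= #|boundary A|.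
Proof.
move=> eW coverW; have [->|[x0 x0W]] := set_0Vmem W; first by rewrite cards0.
pose end_in e := odflt x0 [pick x in ends e :&: W].
apply: leq_trans (leq_imset_card end_in _); apply/subset_leq_card/subsetP => x xW.
have [e eA xe] := coverW x xW; apply/imsetP; exists e => //.
have /eqP/cards1P[y Dy] := eW e.
have xy : x = y by apply/set1P; rewrite -Dy inE xe.
rewrite /end_in Dy; case: pickP => [z /set1P ->|/(_ y)] //; by rewrite set11.
Qed.

End InducedAtoms.

(** * The characterization *)

Theorem theorem5p4 (G : mgraph) (V1 V2 : {set G}) (d1 d2 : nat)
    (Gconn : connected G)
    (Ght : half_transitive V1 V2)
    (Gdelta : 2 * max_mult G <= min_degree G)
    (Gd1 : forall x : G, x \in V1 -> degree x = d1)
    (Gd2 : forall x : G, x \in V2 -> degree x = d2)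
    (GV1 : min_edge_degree G <= #|V1|)
    (GV2 : min_edge_degree G <= #|V2|) :
  ~ lambda'_optimal G <->
  exists A : {set G},
    [/\ A \proper [set: G],
        connected (induced A),
        @half_transitive (induced A) (trace A V1) (trace A V2)
      & exists d1' d2' : nat,
        [/\ forall x : induced A, x \in trace A V1 -> degree x = d1',
            forall x : induced A, x \in trace A V2 -> degree x = d2',
            d1' < d1,
            d2' < d2
          & #|V1 :&: A| * (d1 - d1') + #|V2 :&: A| * (d2 - d2')
              <= min_edge_degree G - 1]].
Proof.
have [Gbip trans1 trans2] := Ght; have [V1n0 V2n0 _ _ cV] := Gbip.
apply: iff_trans (not_optimalP Gconn Gbip Gdelta) _; split=> [[X sepX ltX]|].
  have [A atomA leAX] := ex_atom sepX; have ltA := leq_ltn_trans leAX ltX.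
  have [[/andP[eA eAC] _] _] := atomA.
  have bipA := trace_bipartition eA Gbip; have [tr1 tr2 _ _ _] := bipA.
  have [d1' D1' lt1] :=
    atom_side_degree Gconn Gdelta atomA ltA trans1 (fun e => proj1 (cV e)) Gd1 tr1.
  have [d2' D2' lt2] :=
    atom_side_degree Gconn Gdelta atomA ltA trans2 (fun e => proj2 (cV e)) Gd2 tr2.
  exists A; split; first 1 last.
  - exact: atom_connected.
  - by split; rewrite //; apply: atom_transitive.
  - exists d1', d2'; split=> //; rewrite -(card_boundary_sides Gbip Gd1 Gd2 D1' D2').
    by rewrite subn1 -ltnS (ltn_predK ltA).
  rewrite properT; apply: contraL eAC => /eqP ->; rewrite setCT.
  by apply/has_edgeP => -[x [y [/[!inE]]]].
case=> A [_ Aconn [bipA _ _] [d1' [d2' [D1' D2' lt1 lt2]]]].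
rewrite -(card_boundary_sides Gbip Gd1 Gd2 D1' D2') => leA.
have exit2 x : x \in V2 -> x \in A -> 0 < valency x (~: A).
  move=> xV2 xA; have := D2' (exist _ x xA); rewrite inE induced_valency /= => /(_ xV2).
  by have := Gd2 x xV2; rewrite (degree_valency x A); lia.
have eA : has_edge A.
  by have /card_gt0P[e _] := bip_has_edge Aconn bipA; apply/existsP;
    exists (val e); exact: (valP e).
have ltA : #|boundary A| < min_edge_degree G.
  have [_ /set0Pn[x xA2] _ _ _] := bipA; rewrite inE in xA2.
  have /valency_gt0P[y yA /mult_gt0P[e De]] := exit2 _ xA2 (valP x).
  have : 0 < #|boundary A|; last by lia.
  apply/card_gt0P; exists e; rewrite (in_boundary A De) (valP x).
  by rewrite inE in yA.
(* If the complement were edgeless, every vertex of [V2] would have an edge in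
   the boundary of [A], which is too small for that. *)
exists A => //; rewrite /separating eA /=; apply: contraLR ltA => noAC.
rewrite -leqNgt; apply: leq_trans GV2 _; apply: (leq_side_boundary (fun e => proj2 (cV e))).
move=> x xV2; case: (boolP (x \in A)) => xA.
  have /valency_gt0P[y yA /mult_gt0P[e De]] := exit2 _ xV2 xA.
  by exists e; rewrite ?De ?set21 // (in_boundary A De) xA; rewrite inE in yA.
have xAC : x \in ~: A by rewrite inE.
have := bip_degree_gt0 Gconn Gbip Gdelta x.
rewrite (degree_valency x (~: A)) setCK (valency_edgeless noAC xAC) add0n.
case/valency_gt0P=> y yA /mult_gt0P[e De].
by exists e; rewrite ?De ?set21 // (in_boundary A De) yA (negbTE xA).
Qed.
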